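(* Consider the linear program $\mathrm{LP}$ (the LP relaxation of the path-based ILP for Minimum Shortest-Path Network Design, as defined in the context) and the linear program $\mathrm{LP}^+$ obtained from $\mathrm{LP}$ by adding the subpath constraints $$z_{P[s,v]}\ \ge\ z_P \quad\text{and}\quad z_{P[v,t]}\ \ge\ z_P \qquad \forall (s,t)\in K,\ P\in\mathcal{P}_{s,t},\ v\in V(P),$$ where $P[u,w]$ denotes the subpath of $P$ from vertex $u$ to vertex $w$. Then the subpath constraints are polyhedrally strengthening, even when all arc lengths are $1$: there exists an instance $(G,\mathit{ccap},\mathit{len},p,T)$ with $\mathit{len}(a)=1$ for all arcs $a$ such that the optimal value of $\mathrm{LP}^+$ is strictly larger than the optimal value of $\mathrm{LP}$.
   Context: An instance consists of a directed graph $G=(V,A)$, arc capacities $\mathit{ccap}\colon A\to\mathbb{N}_{\ge1}$ (capacity of one connection), arc lengths $\mathit{len}\colon A\to\mathbb{N}_{\ge1}$, numbers of connections $p\colon A\to\mathbb{N}_{\ge1}$ (link $a$ consists of $p(a)$ individually deactivatable connections of capacity $\mathit{ccap}(a)$ each), and a traffic matrix $T\in\mathbb{N}^{|V|\times|V|}$. The terminal pairs are $K=\{(s,t)\in V^2: T(s,t)>0\}$. For $(s,t)\in K$, $\mathcal{P}_{s,t}$ is the set of all (simple) $s$-$t$-paths in $G$, and $|P|$ is the number of arcs of a path $P$. It is assumed that shortest paths are unique: for each $(s,t)$ the lengths induce a total order $\prec$ on $\mathcal{P}_{s,t}$ (by total length, ties broken arbitrarily), $P\prec P'$ meaning $P$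 comes before (is shorter than) $P'$. The paper also assumes that $T$ is routable along shortest paths in the full network. The linear program $\mathrm{LP}$ has variables $x_a,y_a$ for $a\in A$ and $z_P$ for $P\in\mathcal{P}_{s,t}$, $(s,t)\in K$, and reads: minimize $\sum_{a\in A}x_a$ subject to (i) $\sum_{P\in\mathcal{P}_{s,t}} z_P\ge 1$ for all $(s,t)\in K$; (ii) $\sum_{P\in\mathcal{P}_{s,t}: a\in P} z_P\le y_a$ for all $(s,t)\in K$, $a\in A$; (iii) $\sum_{(s,t)\in K}\sum_{P\in\mathcal{P}_{s,t}: a\in P} T(s,t)\, z_P\le \mathit{ccap}(a)\, x_a$ for all $a\in A$; (iv) $|P|-\sum_{a\in P} y_a\ \ge \sum_{P'\in\mathcal{P}_{s,t}: P\prec P'} z_{P'}$ for all $(s,t)\in K$, $P\in\mathcal{P}_{s,t}$; (v) $y_a\le x_a$ and $x_a\le p(a)\, y_a$ for all $a\in A$; (vi) $0\le x_a\le p(a)$, $0\le y_a\le 1$ for all $a\in A$, and $z_P\ge 0$ for all paths $P$. (This is the relaxation of the ILP in which $x_a\in\{0,\dots,p(a)\}$ is the number of active connections of $a$, $y_a\in\{0,1\}$ indicates whether $a$ is active, and $z_P\in\{0,1\}$ indicates whether $P$ is the active shortest $s$-$t$-path.) *)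

(* Defs.v *)
(* MathComp; the reals are an arbitrary realType. *)
From HB Require Import structures.
From mathcomp Require Import all_boot all_order all_algebra.
From mathcomp Require Import reals.

Set Implicit Arguments.
Unset Strict Implicit.
Unset Printing Implicit Defensive.

Import Order.TTheory GRing.Theory Num.Theory.
Local Open Scope ring_scope.

(* Arcs are ordered pairs of vertices; arc data outside [arcset] is junk and is
   never inspected. *)
Record instance := Instance {
  vertex : finType;
  arcset : {set vertex * vertex};
  ccap : vertex * vertex -> nat;
  len : vertex * vertex -> nat;
  nconn : vertex * vertex -> nat;
  traffic : vertex * vertex -> nat;
  ccap_ge1 : forall a, a \in arcset -> (1 <= ccap a)%N;
  len_ge1 : forall a, a \in arcset -> (1 <= len a)%N;
  nconn_ge1 : forall a, a \in arcset -> (1 <= nconn a)%N }.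

Definition terminals (I : instance) : {set vertex I * vertex I} :=
  [set st | (0 < traffic st)%N].

(* A simple path is given by its duplicate-free list of vertices, which has
   at most #|vertex I| entries; this makes the path variables range over a
   finite type. *)
Definition vseq (I : instance) : finType := #|vertex I|.-bseq (vertex I).

Definition is_path (I : instance) (st : vertex I * vertex I)
    (P : seq (vertex I)) : bool :=
  if P is u :: q then
    [&& u == st.1, last u q == st.2, uniq P
      & path (fun v w => (v, w) \in arcset I) u q]
  else false.

Definition paths (I : instance) (st : vertex I * vertex I) : {set vseq I} :=
  [set P : vseq I | is_path st P].

Definition arcs (I : instance) (P : vseq I) : seq (vertex I * vertex I) :=
  zip P (behead P).

Definition path_len (I : instance) (P : vseq I) : nat :=
  (\sum_(a <- arcs P) len a)%N.

(* For P in [paths (s, t)] and v on P, these are P[s,v] and P[v,t]. *)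
Definition path_upto (I : instance) (v : vertex I) (P : vseq I) : vseq I :=
  [bseq of take (index v P).+1 P].

Definition path_from (I : instance) (v : vertex I) (P : vseq I) : vseq I :=
  widen_bseq (leq_subr (index v P) #|vertex I|) [bseq of drop (index v P) P].

(* [prec] orders every P_{s,t} strictly and totally by length, with an
   arbitrary choice among paths of the same length. As a path determines its
   end vertices, a single relation carries the orders of all pairs (s, t). *)
Definition path_order (I : instance) (prec : rel (vseq I)) : Prop :=
  forall st, st \in terminals I ->
    [/\ {in paths st, irreflexive prec},
        {in paths st & &, transitive prec},
        {in paths st &, forall P Q, P != Q -> prec P Q || prec Q P}
      & {in paths st &, forall P Q, (path_len P < path_len Q)%N -> prec P Q}].

Lemma path_order_exists (I : instance) :
  exists prec : rel (vseq I), path_order prec.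
Proof.
exists (fun P Q => (path_len P < path_len Q)%N ||
  (path_len P == path_len Q) && (enum_rank P < enum_rank Q)%N) => st _; split.
- by move=> P _; rewrite !ltnn andbF.
- move=> Q P R _ _ _ /orP[PQ|/andP[/eqP-> PQ]] /orP[QR|/andP[/eqP eQR QR]].
  + by rewrite (ltn_trans PQ QR).
  + by rewrite -eQR PQ.
  + by rewrite QR.
  + by rewrite eQR eqxx (ltn_trans PQ QR) orbT.
- move=> P Q _ _; case: ltngtP => //= _.
  by rewrite -neq_ltn (inj_eq val_inj) (inj_eq enum_rank_inj).
- by move=> P Q _ _ ->.
Qed.

Definition shortest (I : instance) (prec : rel (vseq I))
    (st : vertex I * vertex I) (P : vseq I) : bool :=
  (P \in paths st) && [forall Q in paths st, (Q != P) ==> prec P Q].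

(* With all connections active, every terminal pair is connected and sending
   all traffic along the shortest paths respects the capacities. *)
Definition routable (I : instance) (prec : rel (vseq I)) : Prop :=
  (forall st, st \in terminals I -> exists P, shortest prec st P) /\
  (forall a, a \in arcset I ->
    (\sum_(st in terminals I)
       \sum_(P | shortest prec st P && (a \in arcs P)) traffic st
     <= ccap a * nconn a)%N).

(* Variables of the linear program; only [xvar a], [yvar a] for a in [arcset I]
   and [zvar P] for P in some [paths st], st in [terminals I], are used. *)
Record lp_vars (R : realType) (I : instance) := LPVars {
  xvar : vertex I * vertex I -> R;
  yvar : vertex I * vertex I -> R;
  zvar : vseq I -> R }.

Record LP (R : realType) (I : instance) (prec : rel (vseq I))
    (w : lp_vars R I) : Prop := {
  LP_connect : forall st, st \in terminals I ->
    \sum_(P in paths st) zvar w P >= 1;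
  LP_active : forall st a, st \in terminals I -> a \in arcset I ->
    \sum_(P in paths st | a \in arcs P) zvar w P <= yvar w a;
  LP_capacity : forall a, a \in arcset I ->
    \sum_(st in terminals I) \sum_(P in paths st | a \in arcs P)
       (traffic st)%:R * zvar w P <= (ccap a)%:R * xvar w a;
  LP_shortest : forall st P, st \in terminals I -> P \in paths st ->
    (size (arcs P))%:R - \sum_(a <- arcs P) yvar w a
      >= \sum_(Q in paths st | prec P Q) zvar w Q;
  LP_link : forall a, a \in arcset I ->
    yvar w a <= xvar w a /\ xvar w a <= (nconn a)%:R * yvar w a;
  LP_xbound : forall a, a \in arcset I -> 0 <= xvar w a <= (nconn a)%:R;
  LP_ybound : forall a, a \in arcset I -> 0 <= yvar w a <= 1;
  LP_zbound : forall st P, st \in terminals I -> P \in paths st ->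
    0 <= zvar w P }.

(* The variable of a subpath exists only if the end vertices of the subpath
   form a terminal pair, so the constraint is imposed exactly in that case. *)
Definition subpath_constraints (R : realType) (I : instance)
    (w : lp_vars R I) : Prop :=
  forall st P v, st \in terminals I -> P \in paths st -> v \in P ->
    ((st.1, v) \in terminals I -> zvar w (path_upto v P) >= zvar w P) /\
    ((v, st.2) \in terminals I -> zvar w (path_from v P) >= zvar w P).

Definition LPplus (R : realType) (I : instance) (prec : rel (vseq I))
    (w : lp_vars R I) : Prop :=
  LP prec w /\ subpath_constraints w.

Definition objective (R : realType) (I : instance) (w : lp_vars R I) : R :=
  \sum_(a in arcset I) xvar w a.

Definition optimal_value (R : realType) (I : instance)
    (feasible : lp_vars R I -> Prop) (c : R) : Prop :=
  (exists2 w, feasible w & objective w = c) /\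
  (forall w, feasible w -> c <= objective w).

(* Main.v *)
Require Import Defs.
From HB Require Import structures.
From mathcomp Require Import all_boot all_order all_algebra.
From mathcomp Require Import reals.
From mathcomp Require Import lra.

(* The graph is a chain of two blocks: s and v are joined by s-a-v (called A)
   and by the longer s-b-b'-v (B); v and t are joined by the arc v-t (D) and by
   v-e-t (E). The pairs (s,a) and (a,v) force both arcs of A to be fully active,
   so (iv) for A forbids the pair (s,v) to use B at all. The heavy pair (s,t)
   would prefer B, where capacity is cheap. Constraint (iv) for AD excludes
   z_BD, but since D and E need not be fully active it still admits z_BE = 2/3;
   more precisely the cost is at least 15 - 6 z_BE, and z_BE <= 2/3 by (iv) for
   AE. The subpath constraint at v gives z_BE <= z_B = 0. Hence the optimal
   values are 11 and 15. *)

Import Order.TTheory GRing.Theory Num.Theory.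
Local Open Scope ring_scope.

(** * The two-block instance *)

Inductive vtx := vs | va | vv | vb | vb' | ve | vt.

Definition vtx_code (x : vtx) : nat :=
  match x with
  | vs => 0 | va => 1 | vv => 2 | vb => 3 | vb' => 4 | ve => 5 | vt => 6
  end.

Definition vtx_decode (n : nat) : vtx :=
  match n with
  | 0 => vs | 1 => va | 2 => vv | 3 => vb | 4 => vb' | 5 => ve | _ => vt
  end.

Lemma vtx_codeK : cancel vtx_code vtx_decode.
Proof. by case. Qed.

HB.instance Definition _ := Countable.copy vtx (can_type vtx_codeK).

Lemma vtx_enumP : Finite.axiom [:: vs; va; vv; vb; vb'; ve; vt].
Proof. by case. Qed.

HB.instance Definition _ := isFinite.Build vtx vtx_enumP.

Lemma card_vtx : #|{: vtx}| = 7.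
Proof. by rewrite cardE enumT unlock. Qed.

Definition arc_seq : seq (vtx * vtx) :=
  [:: (vs, va); (va, vv); (vs, vb); (vb, vb'); (vb', vv);
      (vv, vt); (vv, ve); (ve, vt)].

(** Outside A one connection carries the whole demand 5 of (s,t), so capacity there costs only the
    routed share; on A every unit of traffic costs a unit of [xvar]. *)
Definition gap_ccap (a : vtx * vtx) : nat :=
  if a \in [:: (vs, va); (va, vv)] then 1%N else 5%N.

Definition terminal_seq : seq (vtx * vtx) :=
  [:: (vs, va); (va, vv); (vs, vv); (vs, vt)].

Definition gap_traffic (st : vtx * vtx) : nat :=
  if st == (vs, vt) then 5%N else (st \in terminal_seq).

Lemma gap_ccap_ge1 a : a \in [set x in arc_seq] -> (1 <= gap_ccap a)%N.
Proof. by rewrite /gap_ccap; case: ifP. Qed.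

(** The 8 connections per link match the total traffic 1 + 1 + 1 + 5. *)
Definition gap_instance : instance :=
  @Instance vtx [set x in arc_seq] gap_ccap (fun=> 1%N) (fun=> 8%N)
    gap_traffic gap_ccap_ge1 (fun _ _ => isT) (fun _ _ => isT).

Local Notation G := gap_instance.

Lemma terminalsE : terminals G = [set st in terminal_seq].
Proof. by apply/setP => -[[] []]; rewrite !inE. Qed.

(** The bound is stated with the literal 7, so that [isT] proves it for concrete lists, and then
    transported along [card_vtx]. *)
Definition vpath (l : seq vtx) (hl : (size l <= 7)%N) : vseq G :=
  Bseq (eq_ind_r (fun n => size l <= n)%N hl card_vtx).

Definition pA : vseq G := vpath [:: vs; va; vv] isT.
Definition pB : vseq G := vpath [:: vs; vb; vb'; vv] isT.
Definition pAD : vseq G := vpath [:: vs; va; vv; vt] isT.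
Definition pAE : vseq G := vpath [:: vs; va; vv; ve; vt] isT.
Definition pBD : vseq G := vpath [:: vs; vb; vb'; vv; vt] isT.
Definition pBE : vseq G := vpath [:: vs; vb; vb'; vv; ve; vt] isT.
Definition psa : vseq G := vpath [:: vs; va] isT.
Definition pav : vseq G := vpath [:: va; vv] isT.

(** * Enumeration of terminal pairs, arcs and paths *)

Definition path_seq (st : vtx * vtx) : seq (vseq G) :=
  match st with
  | (vs, va) => [:: psa]
  | (va, vv) => [:: pav]
  | (vs, vv) => [:: pA; pB]
  | (vs, vt) => [:: pAD; pAE; pBD; pBE]
  | _ => [::]
  end.

Lemma terminal_ind (Q : vtx * vtx -> Prop) :
  Q (vs, va) -> Q (va, vv) -> Q (vs, vv) -> Q (vs, vt) ->
  forall st, st \in terminals G -> Q st.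
Proof.
move=> Q1 Q2 Q3 Q4 st; rewrite terminalsE !inE.
by case/or4P => /eqP->.
Qed.

Lemma arc_ind (Q : vtx * vtx -> Prop) :
  Q (vs, va) -> Q (va, vv) -> Q (vs, vb) -> Q (vb, vb') -> Q (vb', vv) ->
  Q (vv, vt) -> Q (vv, ve) -> Q (ve, vt) ->
  forall a, a \in arcset G -> Q a.
Proof.
move=> Q1 Q2 Q3 Q4 Q5 Q6 Q7 Q8 a; rewrite !inE.
by do 7?[case/orP => [/eqP->//|]] => /eqP->.
Qed.

Lemma pathsE st : st \in terminals G ->
  paths (I := G) st = [set P in path_seq st].
Proof.
move: st; apply: terminal_ind; apply/setP => -[q hq]; rewrite !inE -?val_eqE /=.
all: apply/idP/idP; last by do ?[case/orP]; move/eqP=> ->; rewrite /= !inE.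
all: case: q {hq} => [|u q] //= /and4P[/eqP-> + _].
(* The graph is acyclic and its walks have at most five arcs, so six splits on the next vertex
   exhaust them; a non-arc makes the path condition false. *)
all: do 6?[case: q => [|[] q] //=; rewrite ?inE //=].
Qed.

Lemma path_seq_uniq st : uniq (path_seq st).
Proof. by case: st => -[] []. Qed.

Lemma sum_paths (M : nmodType) st (F : vseq G -> M) : st \in terminals G ->
  \sum_(P in paths (I := G) st) F P = \sum_(P <- path_seq st) F P.
Proof.
move=> stK; rewrite [RHS]big_uniq ?path_seq_uniq //=.
by apply: eq_bigl => P; rewrite pathsE // inE.
Qed.

Lemma sum_paths_cond (M : nmodType) st (c : pred (vseq G)) (F : vseq G -> M) :
  st \in terminals G ->
  \sum_(P in paths (I := G) st | c P) F P = \sum_(P <- path_seq st | c P) F P.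
Proof. by move=> stK; rewrite big_mkcondr sum_paths // [RHS]big_mkcond. Qed.

Lemma sum_terminals (M : nmodType) (F : vtx * vtx -> M) :
  \sum_(st in terminals G) F st = \sum_(st <- terminal_seq) F st.
Proof.
rewrite [RHS]big_uniq //=.
by apply: eq_bigl => st; rewrite terminalsE inE.
Qed.

Lemma sum_arcs (M : nmodType) (F : vtx * vtx -> M) :
  \sum_(a in arcset G) F a = \sum_(a <- arc_seq) F a.
Proof.
rewrite [RHS]big_uniq //=.
by apply: eq_bigl => st; rewrite inE.
Qed.

(** The [foldr] computes to a conjunction with one conjunct per listed path once [st] is
    concrete. *)
Lemma path_ind st (Q : vseq G -> Prop) :
  st \in terminals G -> foldr (fun P A => Q P /\ A) True (path_seq st) ->
  forall P, P \in paths (I := G) st -> Q P.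
Proof.
move=> stK; rewrite pathsE //; elim: (path_seq st) => [|P0 l IHl] /=.
  by move=> _ P; rewrite inE.
move=> [QP0 Ql] P; rewrite !inE => /orP[/eqP->//|Pl].
by apply: IHl; rewrite ?inE.
Qed.

(** * Consequences of an arbitrary path order; routability *)

Section Order.

Variables (prec : rel (vseq G)) (prec_order : path_order prec).

Lemma precxx st P : st \in terminals G -> P \in paths (I := G) st ->
  prec P P = false.
Proof. by move=> stK; case: (prec_order st stK) => irr _ _ _; apply: irr. Qed.

(** With unit lengths, [path_len] counts arcs; the second half is asymmetry, from transitivity and
    irreflexivity. *)
Lemma prec_shorter st P Q : st \in terminals G ->
  P \in paths (I := G) st -> Q \in paths (I := G) st ->
  (size (arcs P) < size (arcs Q))%N -> prec P Q /\ prec Q P = false.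
Proof.
move=> stK PK QK ltPQ; case: (prec_order st stK) => irr tr _ lenP.
have PQ : prec P Q.
  by apply: lenP => //; rewrite /path_len !sum1_size.
split=> //; apply/negP => QP.
by have := irr P PK; rewrite (tr _ _ _ QK PK PK PQ QP).
Qed.

Lemma path_seq_paths st P : st \in terminals G -> P \in path_seq st ->
  P \in paths (I := G) st.
Proof. by move=> stK; rewrite pathsE // inE. Qed.

(** Reduces minimality to a computable comparison of arc counts, valid for every choice of
    tie-breaking. *)
Lemma shortest_head st P : st \in terminals G ->
  P \in path_seq st ->
  all (fun Q => (Q == P) || (size (arcs P) < size (arcs Q))%N) (path_seq st) ->
  shortest prec st P.
Proof.
move=> stK Pst /allP Pmin; have PK := path_seq_paths _ _ stK Pst.
rewrite /shortest PK; apply/forall_inP => Q QK; apply/implyP => neQP.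
have := Pmin Q; rewrite (negPf neQP) => ltPQ.
suff : (size (arcs P) < size (arcs Q))%N.
  by move=> /(prec_shorter _ _ _ stK PK QK)[].
by apply: ltPQ; move: QK; rewrite pathsE // inE.
Qed.

Lemma shortest_inj st P Q : st \in terminals G ->
  shortest prec st P -> shortest prec st Q -> P = Q.
Proof.
move=> stK /andP[PK /forall_inP Pmin] /andP[QK /forall_inP Qmin].
case: (prec_order st stK) => irr tr _ _.
apply/eqP/negPn/negP => nePQ.
have PQ := implyP (Pmin Q QK); have QP := implyP (Qmin P PK).
have := irr P PK; rewrite (tr _ _ _ QK PK PK (PQ _) (QP nePQ)) //.
by rewrite eq_sym.
Qed.

Lemma gap_routable : routable prec.
Proof.
split.
  apply: terminal_ind.
  - by exists psa; apply: shortest_head; rewrite ?terminalsE ?inE.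
  - by exists pav; apply: shortest_head; rewrite ?terminalsE ?inE.
  - by exists pA; apply: shortest_head; rewrite ?terminalsE ?inE.
  - by exists pAD; apply: shortest_head; rewrite ?terminalsE ?inE.
(* Each link can carry all 8 units of traffic, and a pair loads it with at most its own demand
   because its shortest path is unique. *)
move=> a aA; apply: (@leq_trans 8); last first.
  by apply: leq_pmull; apply: ccap_ge1.
have -> : (8 = \sum_(st in terminals G) gap_traffic st)%N.
  by rewrite sum_terminals /terminal_seq !big_cons big_nil.
apply: leq_sum => st stK; rewrite sum_nat_const.
rewrite -[leqRHS]mul1n leq_mul2r; apply/orP; right.
apply/card_le1_eqP => P Q /andP[shP _] /andP[shQ _].
exact: (shortest_inj st).
Qed.

End Order.

(** * A family of feasible solutions and the matching lower bound *)

Section Feasible.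

Variable R : realType.

(* Here b is the share of the (s,t) traffic on BE; the rest uses AD. *)
Definition gap_y (b : R) (a : vtx * vtx) : R :=
  if a \in [:: (vs, va); (va, vv)] then 1 else
  if a == (vv, vt) then 1 - b else b.

(** On A, 7 - 5b = 1 + 1 + 5(1 - b): the unit demands of (s,v) and of the pair joined by the arc,
    plus the (s,t) share on AD. *)
Definition gap_x (b : R) (a : vtx * vtx) : R :=
  if a \in [:: (vs, va); (va, vv)] then 7 - 5 * b else gap_y b a.

Definition gap_z (b : R) (P : vseq G) : R :=
  if P == pAD then 1 - b else if P == pBE then b else
  (P \in [:: psa; pav; pA])%:R.

Definition gap_sol (b : R) : lp_vars R G :=
  @LPVars R G (gap_x b) (gap_y b) (gap_z b).

Lemma gap_objective b : objective (gap_sol b) = 15 - 6 * b.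
Proof.
rewrite /objective sum_arcs /arc_seq !big_cons !big_nil.
rewrite /gap_sol /gap_x /gap_y /=.
by lra.
Qed.

Lemma gap_feasible prec (b : R) : path_order prec -> 0 <= b -> 3 * b <= 2 ->
  LP prec (gap_sol b).
Proof.
move=> precO b0 b1; split.
- move=> st stK; rewrite sum_paths //; move: st stK.
  by apply: terminal_ind; rewrite /path_seq /=; rewrite !big_cons !big_nil
    /gap_z /=; lra.
- move=> st a stK aA; rewrite sum_paths_cond //; move: st stK a aA.
  by apply: terminal_ind; apply: arc_ind; rewrite /path_seq /=;
    rewrite !big_cons !big_nil /gap_y /gap_z /=; lra.
- move=> a aA; rewrite sum_terminals.
  rewrite /terminal_seq !big_cons !big_nil !sum_paths_cond ?terminalsE ?inE //.
  move: a aA; apply: arc_ind; rewrite /path_seq /=;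
    by rewrite !big_cons !big_nil /gap_x /gap_y /gap_z /gap_ccap
      /gap_traffic /=; lra.
- move=> st P stK PK; rewrite sum_paths_cond // big_mkcond.
  move: P PK; apply: path_ind => //.
  (* These are the comparisons on which (iv) depends; the remaining ones are split both ways, since
     the slack of (iv) then covers either order. *)
  have irr st' P' : st' \in terminals G -> P' \in path_seq st' ->
      prec P' P' = false.
    by move=> st'K /(path_seq_paths _ _ st'K); apply: precxx.
  have prec_sa : prec psa psa = false.
    by apply: (irr (vs, va)); rewrite ?terminalsE ?inE.
  have prec_av : prec pav pav = false.
    by apply: (irr (va, vv)); rewrite ?terminalsE ?inE.
  have prec_A : prec pA pA = false.
    by apply: (irr (vs, vv)); rewrite ?terminalsE ?inE.
  have prec_AD : prec pAD pAD = false.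
    by apply: (irr (vs, vt)); rewrite ?terminalsE ?inE.
  have [_ prec_AE] : prec pAD pAE /\ prec pAE pAD = false.
    have stK' : (vs, vt) \in terminals G by rewrite terminalsE inE.
    by apply: prec_shorter stK' _ _ _ => //; apply: path_seq_paths;
      rewrite ?inE.
  move: st stK; apply: terminal_ind; rewrite /path_seq /=;
    rewrite !big_cons !big_nil /gap_y /gap_z /= ?prec_sa ?prec_av ?prec_A
      ?prec_AD ?prec_AE ?if_same;
    do ?[apply: conj] => //; by do ?case: ifP => _; lra.
- by apply: arc_ind; split; rewrite /gap_sol /gap_x /gap_y /=; lra.
- by apply: arc_ind; rewrite /gap_sol /gap_x /gap_y /=; apply/andP; split; lra.
- by apply: arc_ind; rewrite /gap_sol /gap_y /=; apply/andP; split; lra.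
- move=> st P stK; move: P; apply: path_ind => //.
  move: st stK; apply: terminal_ind; rewrite /path_seq /gap_sol /gap_z /=;
    do ?[apply: conj] => //; lra.
Qed.

(** At b = 0 the variables equal to 1 are those of AD and of its subpaths joining terminal pairs, a
    family closed under taking such subpaths. *)
Lemma gap_subpath : subpath_constraints (gap_sol 0).
Proof.
move=> st P v stK PK; move: v; move: P PK; apply: path_ind => //.
move: st stK; apply: terminal_ind; rewrite /path_seq /gap_sol /gap_z /=.
all: do ?[apply: conj] => //; case; rewrite ?terminalsE ?inE //= => _.
all: by split=> //= *; lra.
Qed.

Lemma gap_lower_bound prec (w : lp_vars R G) : path_order prec -> LP prec w ->
  [/\ 15 - 6 * zvar w pBE <= objective w, 3 * zvar w pBE <= 2
    & zvar w pB <= 0].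
Proof.
move=> precO [connect active capacity shortest link _ _ zbound].
have [K1 K2 K3 K4] : [/\ (vs, va) \in terminals G, (va, vv) \in terminals G,
    (vs, vv) \in terminals G & (vs, vt) \in terminals G].
  by rewrite terminalsE; split; rewrite inE.
have arcP a : a \in arc_seq -> a \in arcset G by move=> aS; rewrite in_set.
have P3 := path_seq_paths (vs, vv) _ K3.
have P4 := path_seq_paths (vs, vt) _ K4.
have [prec_AB _] : prec pA pB /\ prec pB pA = false.
  by apply: (prec_shorter _ precO _ _ _ K3) => //; apply: P3.
have [prec_ADAE prec_AEAD] : prec pAD pAE /\ prec pAE pAD = false.
  by apply: (prec_shorter _ precO _ _ _ K4) => //; apply: P4.
have [prec_ADBD _] : prec pAD pBD /\ prec pBD pAD = false.
  by apply: (prec_shorter _ precO _ _ _ K4) => //; apply: P4.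
have [prec_ADBE _] : prec pAD pBE /\ prec pBE pAD = false.
  by apply: (prec_shorter _ precO _ _ _ K4) => //; apply: P4.
have [prec_AEBE _] : prec pAE pBE /\ prec pBE pAE = false.
  by apply: (prec_shorter _ precO _ _ _ K4) => //; apply: P4.
have prec_AA := precxx _ precO _ pA K3 (P3 pA isT).
have prec_ADAD := precxx _ precO _ pAD K4 (P4 pAD isT).
have prec_AEAE := precxx _ precO _ pAE K4 (P4 pAE isT).
have zA := zbound _ pA K3 (P3 pA isT).
have zB := zbound _ pB K3 (P3 pB isT).
have zAD := zbound _ pAD K4 (P4 pAD isT).
have zAE := zbound _ pAE K4 (P4 pAE isT).
have zBD := zbound _ pBD K4 (P4 pBD isT).
have zBE := zbound _ pBE K4 (P4 pBE isT).
have c1 := connect _ K1; have c2 := connect _ K2.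
have c3 := connect _ K3; have c4 := connect _ K4.
have act1 := active _ _ K1 (arcP (vs, va) isT).
have act2 := active _ _ K2 (arcP (va, vv) isT).
have act3 := active _ _ K4 (arcP (vs, vb) isT).
have act4 := active _ _ K4 (arcP (vb, vb') isT).
have act5 := active _ _ K4 (arcP (vb', vv) isT).
have act6 := active _ _ K4 (arcP (vv, vt) isT).
have act7 := active _ _ K4 (arcP (vv, ve) isT).
have act8 := active _ _ K4 (arcP (ve, vt) isT).
have cap1 := capacity _ (arcP (vs, va) isT).
have cap2 := capacity _ (arcP (va, vv) isT).
have sA := shortest _ pA K3 (P3 pA isT).
have sAD := shortest _ pAD K4 (P4 pAD isT).
have sAE := shortest _ pAE K4 (P4 pAE isT).
have [x3 _] := link _ (arcP (vs, vb) isT).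
have [x4 _] := link _ (arcP (vb, vb') isT).
have [x5 _] := link _ (arcP (vb', vv) isT).
have [x6 _] := link _ (arcP (vv, vt) isT).
have [x7 _] := link _ (arcP (vv, ve) isT).
have [x8 _] := link _ (arcP (ve, vt) isT).
move: cap1 cap2; rewrite !sum_terminals /terminal_seq !big_cons !big_nil.
rewrite !sum_paths_cond //.
rewrite /path_seq /=; rewrite !big_cons !big_nil /gap_ccap /gap_traffic /=.
move=> cap1 cap2.
move: c1 c2 c3 c4; rewrite !sum_paths // /path_seq /=.
rewrite !big_cons !big_nil => c1 c2 c3 c4.
move: act1 act2 act3 act4 act5 act6 act7 act8.
rewrite !sum_paths_cond // /path_seq /=.
rewrite !big_cons !big_nil /= => act1 act2 act3 act4 act5 act6 act7 act8.
move: sA sAD sAE; rewrite !sum_paths_cond // /path_seq /=.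
rewrite !big_cons !big_nil /= prec_AA prec_AB prec_ADAE prec_ADBD prec_ADBE
  prec_AEBE prec_ADAD prec_AEAD prec_AEAE.
rewrite /objective sum_arcs /arc_seq !big_cons !big_nil.
(* AE and BD tie at four arcs, so either order can occur. By (iv) for AD, (ii) at v-t and (i), z_BD
   = 0 and the (s,t) weights sum to 1. Each arc of A then costs at least 7 - 5 z_BE, B at least 3
   z_BE, and the second block at least z_AD + 2(z_AE + z_BE); the sum is 15 - 6 z_BE + z_AE. *)
by case: (prec pAE pBD) => sA sAD sAE; split; lra.
Qed.

End Feasible.

(** * The two optimal values *)

Theorem theorem1 (R : realType) :
  exists I : instance,
    (forall a, a \in arcset I -> len a = 1%N) /\
    (forall prec : rel (vseq I), path_order prec ->
       routable prec /\
       exists c cplus : R,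
         [/\ optimal_value (LP (R := R) prec) c,
             optimal_value (LPplus (R := R) prec) cplus
           & c < cplus]).
Proof.
exists gap_instance; split=> // prec precO; split; first exact: gap_routable.
exists 11, 15; split; last by lra.
- split.
    exists (gap_sol R (2 / 3)); last by rewrite gap_objective; lra.
    by apply: gap_feasible => //; lra.
  move=> w wLP; have [objw zBE _] := gap_lower_bound _ _ _ precO wLP; lra.
- split.
    exists (gap_sol R 0); last by rewrite gap_objective; lra.
    by split; [apply: gap_feasible => //; lra | apply: gap_subpath].
  move=> w [wLP sub]; have [objw _ zB] := gap_lower_bound _ _ _ precO wLP.
  have [K3 K4] : (vs, vv) \in terminals G /\ (vs, vt) \in terminals G.
    by rewrite terminalsE; split; rewrite inE.
  have [] := sub (vs, vt) pBE vv K4 (path_seq_paths _ pBE K4 isT) isT.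
  move=> /(_ K3) + _.
  (* Bounded sequences agree once their vertex lists do, and cutting BE after v leaves the list of
     B. *)
  have -> : path_upto (I := G) vv pBE = pB by apply: val_inj.
  by lra.
Qed.
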